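(* Let $G$ be an abelian group of odd order. Then up to $G$-equivariant isometry there is a unique $G$-invariant, symmetric, nondegenerate $\mathbb{F}_2$-bilinear form on $\mathbb{F}_2[G]$, namely $$b\colon\mathbb{F}_2[G]\times\mathbb{F}_2[G]\to\mathbb{F}_2,\qquad b(x,y)=\operatorname{Tr}(x^*y).$$ That is, $b$ is $G$-invariant, symmetric and nondegenerate, and for every $G$-invariant symmetric nondegenerate $\mathbb{F}_2$-bilinear form $b'$ on $\mathbb{F}_2[G]$ there is a $G$-equivariant $\mathbb{F}_2$-linear automorphism $\phi$ of $\mathbb{F}_2[G]$ with $b'(\phi x,\phi y)=b(x,y)$ for all $x,y$.
   Context: $x\mapsto x^*$ is the $\mathbb{F}_2$-linear involution of $\mathbb{F}_2[G]$ extending $\sigma\mapsto\sigma^{-1}$ for $\sigma\in G$. $\operatorname{Tr}\colon\mathbb{F}_2[G]\to\mathbb{F}_2$ is the trace of the commutative $\mathbb{F}_2$-algebra $\mathbb{F}_2[G]$ (trace of multiplication). A form $b$ is $G$-invariant if $b(\sigma x,\sigma y)=b(x,y)$ for all $\sigma\in G$. *)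

(* Defs.v *)
From HB Require Import structures.
From mathcomp Require Import all_boot all_fingroup all_algebra all_field.

Set Implicit Arguments.
Unset Strict Implicit.
Unset Printing Implicit Defensive.

Import GRing.Theory.
Local Open Scope ring_scope.

(* The group algebra K[gT], as functions gT -> K: x stands for the formal sum
   of the x g . g. This is a separate name for the finfun type because the
   library equips {ffun gT -> K} with the pointwise product, whereas galg K gT
   carries the convolution product. *)
Definition galg (K : fieldType) (gT : finGroupType) : Type :=
  {ffun gT -> K^o}.

Section GroupAlgebra.

Variables (K : fieldType) (gT : finGroupType).
Implicit Types (x y z : galg K gT) (g h : gT).

HB.instance Definition _ := Vector.copy (galg K gT) {ffun gT -> K^o}.

Definition gcoef x g : K := (x : {ffun gT -> K^o}) g.

Definition gelt g : galg K gT := [ffun h => (h == g)%:R].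

Definition gmul x y : galg K gT :=
  [ffun g => \sum_(h : gT) gcoef x h * gcoef y (h^-1 * g)%g].

Lemma galgP x y : gcoef x =1 gcoef y -> x = y.
Proof. by move=> exy; apply/ffunP. Qed.

Lemma gcoefD x y g : gcoef (x + y) g = gcoef x g + gcoef y g.
Proof. by rewrite /gcoef ffunE. Qed.

Lemma gcoefZ (a : K) x g : gcoef (a *: x) g = a * gcoef x g.
Proof. by rewrite /gcoef ffunE. Qed.

Lemma gcoef_gelt g h : gcoef (gelt g) h = (h == g)%:R.
Proof. by rewrite /gcoef ffunE. Qed.

Lemma gcoef_gmul x y g :
  gcoef (gmul x y) g = \sum_h gcoef x h * gcoef y (h^-1 * g)%g.
Proof. by rewrite /gcoef ffunE. Qed.

Fact gmulA : associative gmul.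
Proof.
move=> x y z; apply: galgP => g; rewrite !gcoef_gmul.
under eq_bigr do rewrite gcoef_gmul mulr_sumr.
under [RHS]eq_bigr do rewrite gcoef_gmul mulr_suml.
rewrite [RHS]exchange_big /=; apply: eq_bigr => h _.
rewrite (reindex_inj (mulgI h^-1%g)) /=; apply: eq_bigr => k _.
by rewrite mulrA invMg invgK -!mulgA mulKVg.
Qed.

Fact gmul1l : left_id (gelt 1%g) gmul.
Proof.
move=> x; apply: galgP => g; rewrite gcoef_gmul (bigD1 1%g) //= big1 => [|h h1].
  by rewrite gcoef_gelt eqxx mul1r invg1 mul1g addr0.
by rewrite gcoef_gelt (negPf h1) mul0r.
Qed.

Fact gmul1r : right_id (gelt 1%g) gmul.
Proof.
move=> x; apply: galgP => g; rewrite gcoef_gmul (bigD1 g) //= big1 => [|h hg].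
  by rewrite gcoef_gelt mulVg eqxx mulr1 addr0.
by rewrite gcoef_gelt -eq_mulVg1 (negPf hg) mulr0.
Qed.

Fact gmulDl : left_distributive gmul +%R.
Proof.
move=> x y z; apply: galgP => g; rewrite gcoefD !gcoef_gmul -big_split /=.
by apply: eq_bigr => h _; rewrite gcoefD mulrDl.
Qed.

Fact gmulDr : right_distributive gmul +%R.
Proof.
move=> x y z; apply: galgP => g; rewrite gcoefD !gcoef_gmul -big_split /=.
by apply: eq_bigr => h _; rewrite gcoefD mulrDr.
Qed.

Fact gelt1_neq0 : gelt 1%g != 0.
Proof.
apply/eqP => /(congr1 (gcoef^~ 1%g)) /eqP.
by rewrite gcoef_gelt eqxx /gcoef ffunE oner_eq0.
Qed.

HB.instance Definition _ := GRing.Zmodule_isNzRing.Build (galg K gT)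
  gmulA gmul1l gmul1r gmulDl gmulDr gelt1_neq0.

Lemma gcoefM x y g :
  gcoef (x * y) g = \sum_h gcoef x h * gcoef y (h^-1 * g)%g.
Proof. exact: gcoef_gmul. Qed.

Fact gscaleAl (a : K) x y : a *: (x * y) = (a *: x) * y.
Proof.
apply: galgP => g; rewrite gcoefZ !gcoefM mulr_sumr.
by apply: eq_bigr => h _; rewrite gcoefZ mulrA.
Qed.

HB.instance Definition _ :=
  GRing.Lmodule_isLalgebra.Build K (galg K gT) gscaleAl.

Fact gscaleAr (a : K) x y : a *: (x * y) = x * (a *: y).
Proof.
apply: galgP => g; rewrite gcoefZ !gcoefM mulr_sumr.
by apply: eq_bigr => h _; rewrite gcoefZ mulrCA.
Qed.

HB.instance Definition _ :=
  GRing.Lalgebra_isAlgebra.Build K (galg K gT) gscaleAr.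

HB.instance Definition _ := Algebra_isFalgebra.Build K (galg K gT).

Definition gstar x : galg K gT := \sum_(g : gT) gcoef x g *: gelt g^-1%g.

Lemma gcoef_sum (I : Type) (r : seq I) (P : pred I) (F : I -> galg K gT) g :
  gcoef (\sum_(i <- r | P i) F i) g = \sum_(i <- r | P i) gcoef (F i) g.
Proof. exact: sum_ffunE. Qed.

Lemma galg_sum_gelt x : x = \sum_g gcoef x g *: gelt g.
Proof.
apply: galgP => g; rewrite gcoef_sum (bigD1 g) //= big1 => [|h hg].
  by rewrite gcoefZ gcoef_gelt eqxx mulr1 addr0.
by rewrite gcoefZ gcoef_gelt eq_sym (negPf hg) mulr0.
Qed.

Lemma geltM g h : gelt (g * h)%g = gelt g * gelt h.
Proof.
apply: galgP => k; rewrite gcoefM (bigD1 g) //= big1 => [|l lg].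
  by rewrite !gcoef_gelt eqxx mul1r addr0 (can2_eq (mulKVg g) (mulKg g)).
by rewrite gcoef_gelt (negPf lg) mul0r.
Qed.

Lemma gcoef_gstar x g : gcoef (gstar x) g = gcoef x g^-1%g.
Proof.
rewrite gcoef_sum (bigD1 g^-1%g) //= big1 => [|h hg].
  by rewrite gcoefZ gcoef_gelt invgK eqxx mulr1 addr0.
by rewrite gcoefZ gcoef_gelt -(inj_eq invg_inj) invgK eq_sym (negPf hg) mulr0.
Qed.

Lemma gstar_is_linear : linear gstar.
Proof.
by move=> a x y; apply: galgP=> g; rewrite !(gcoefD, gcoefZ, gcoef_gstar).
Qed.

Lemma gstar_gelt g : gstar (gelt g) = gelt g^-1%g.
Proof.
apply: galgP => h; rewrite gcoef_gstar !gcoef_gelt.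
by rewrite -(inj_eq invg_inj) invgK.
Qed.

Lemma gstarK : involutive gstar.
Proof. by move=> x; apply: galgP => g; rewrite !gcoef_gstar invgK. Qed.

End GroupAlgebra.

(* f2mx is the matrix of an endomorphism in the basis of A fixed by its
   vectType structure; the trace does not depend on that basis. *)
Definition algTr (K : fieldType) (A : falgType K) (a : A) : K :=
  \tr (VectorInternalTheory.f2mx (amull a)).

Definition trace_form (K : fieldType) (gT : finGroupType)
    (x y : galg K gT) : K :=
  algTr (gstar x * y).

Section Forms.

Variables (K : fieldType) (gT : finGroupType).
Implicit Types b : galg K gT -> galg K gT -> K.

Definition form_bilinear b : Prop :=
  (forall y, scalar (b^~ y)) /\ (forall x, scalar (b x)).

Definition form_symmetric b : Prop := forall x y, b x y = b y x.

Definition form_nondegenerate b : Prop :=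
  forall x, (forall y, b x y = 0) -> x = 0.

Definition form_invariant b : Prop :=
  forall (s : gT) x y, b (gelt K s * x) (gelt K s * y) = b x y.

Definition inv_sym_nondeg_form b : Prop :=
  [/\ form_bilinear b, form_invariant b, form_symmetric b
    & form_nondegenerate b].

Definition equivariant (phi : galg K gT -> galg K gT) : Prop :=
  forall (s : gT) x, phi (gelt K s * x) = gelt K s * phi x.

End Forms.

(* Main.v *)
Require Import Defs.
From mathcomp Require Import all_boot all_fingroup all_algebra all_field.
From mathcomp Require Import cyclic.
Local Open Scope ring_scope.

(** Since [G] has odd order, [Tr z] is the coefficient of [z] at [1]. By
    invariance [b' x y] is the coefficient at [1] of [u x^* y] for some [u],
    and [u^* = u] by symmetry. As [g |-> g^2] is a bijection of [G] and
    [F_2[G]] is commutative of characteristic 2, the Frobenius map is bijective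
    on [F_2[G]]: explicitly, [u = v^2] where [v] has coefficient [u_(g^2)] at
    [g], so that also [v^* = v]. Hence [b' x y = b (v x) (v y)];
    multiplication by [v] is injective because [b'] is nondegenerate, and its
    inverse is the required isometry. *)

Set Implicit Arguments.
Unset Strict Implicit.
Unset Printing Implicit Defensive.

Import GRing.Theory VectorInternalTheory.

Section GroupAlgebraTrace.

Variables (K : fieldType) (gT : finGroupType).
Implicit Types (x y : galg K gT) (g h : gT).

Lemma gcoef0 g : gcoef (0 : galg K gT) g = 0.
Proof. by rewrite /gcoef ffunE. Qed.

Lemma scalar_galgE (f : galg K gT -> K) x :
  scalar f -> f x = \sum_g gcoef x g * f (gelt K g).
Proof.
move=> flin; have f0 : f 0 = 0.
  have /esym/eqP := flin 1 0 0.
  by rewrite scaler0 addr0 mul1r -subr_eq0 addrK => /eqP.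
rewrite {1}[x]galg_sum_gelt; apply: (big_rec2 (fun z c => f z = c)) => //.
by move=> g z c _ <-; rewrite flin.
Qed.

Lemma gcoefMgelt x g h : gcoef (x * gelt K g) h = gcoef x (h * g^-1)%g.
Proof.
rewrite gcoefM (bigD1 (h * g^-1)%g) //= big1 => [|k khg].
  by rewrite gcoef_gelt invMg invgK mulgKV eqxx mulr1 addr0.
rewrite gcoef_gelt; case: eqP => [kh|_]; last by rewrite mulr0.
by case/eqP: khg; rewrite -kh invMg invgK mulKVg.
Qed.

Lemma gcoef_geltM x g h : gcoef (gelt K g * x) h = gcoef x (g^-1 * h)%g.
Proof.
rewrite gcoefM (bigD1 g) //= big1 => [|k kg].
  by rewrite gcoef_gelt eqxx mul1r addr0.
by rewrite gcoef_gelt (negPf kg) mul0r.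
Qed.

Lemma gstarM x y : gstar (x * y) = gstar y * gstar x.
Proof.
apply: galgP => g; rewrite gcoef_gstar !gcoefM.
rewrite [RHS](reindex_inj (mulgI g)) /=; apply: eq_bigr => h _.
by rewrite !gcoef_gstar invMg mulgKV invgK mulrC.
Qed.

Lemma galg_mulC x y : abelian [set: gT] -> x * y = y * x.
Proof.
move=> /centsP abG; apply: galgP => g; rewrite !gcoefM.
rewrite [RHS](reindex_inj (mulIg g)) [RHS](reindex_inj invg_inj) /=.
apply: eq_bigr => h _; rewrite mulrC invMg invgK -mulgA.
by rewrite (abG h _ g) ?inE // mulKg.
Qed.

(** [f2mx] refers to the basis [e] fixed by the vector space structure, not to the group elements.
    Expanding $f(e_i)$ in group elements and each group element in the $e_i$ gives the same double
    sum for both traces. *)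
Lemma mxtrace_f2mx (f : 'End(galg K gT)) :
  \tr (f2mx f) = \sum_g gcoef (f (gelt K g)) g.
Proof.
pose e i : galg K gT := r2v (delta_mx 0 i).
transitivity (\sum_i \sum_g gcoef (f (e i)) g * v2r (gelt K g) 0 i).
  apply: eq_bigr => i _.
  have -> : f2mx f i i = v2r (f (e i)) 0 i.
    by rewrite unlock /= r2vK r2vK -rowE mxE.
  rewrite {1}[f (e i)]galg_sum_gelt linear_sum summxE.
  by apply: eq_bigr => g _; rewrite linearZ mxE.
rewrite exchange_big; apply: eq_bigr => g _ /=.
have {2}-> : gelt K g = \sum_i v2r (gelt K g) 0 i *: e i.
  rewrite -[LHS]v2rK {1}[v2r _]row_sum_delta linear_sum.
  by apply: eq_bigr => i _; rewrite linearZ.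
rewrite linear_sum gcoef_sum; apply: eq_bigr => i _.
by rewrite linearZ gcoefZ mulrC.
Qed.

(** In the basis of group elements, every diagonal entry of multiplication by $x$ is $x_1$, since
    the coefficient of $x g$ at $g$ is $x_1$. *)
Lemma algTr_galg x : algTr x = #|gT|%:R * gcoef x 1%g.
Proof.
rewrite /algTr mxtrace_f2mx mulr_natl -sumr_const.
by apply: eq_bigr => g _; rewrite lfunE /= gcoefMgelt mulgV.
Qed.

Lemma trace_formE x y :
  trace_form x y = #|gT|%:R * \sum_g gcoef x g * gcoef y g.
Proof.
rewrite /trace_form algTr_galg gcoefM; congr (_ * _).
rewrite (reindex_inj invg_inj); apply: eq_bigr => g _.
by rewrite gcoef_gstar invgK mulg1.
Qed.

Lemma trace_form_inv_sym_nondeg :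
  #|gT|%:R != 0 :> K -> inv_sym_nondeg_form (@trace_form K gT).
Proof.
move=> nzG; have tfC x y : trace_form x y = trace_form y x.
  by rewrite !trace_formE; congr (_ * _); apply: eq_bigr => g _; rewrite mulrC.
have tf_linear x : scalar (trace_form x).
  move=> a y z; rewrite !trace_formE mulrCA -mulrDr; congr (_ * _).
  rewrite mulr_sumr -big_split; apply: eq_bigr => g _.
  by rewrite gcoefD gcoefZ mulrDr mulrCA.
split=> // [|s x y|x xP].
- by split=> // y a x z; rewrite ![trace_form _ y]tfC tf_linear.
- rewrite !trace_formE (reindex_inj (mulgI s)); congr (_ * _).
  by apply: eq_bigr => g _; rewrite !gcoef_geltM mulKg.
apply: galgP => g; rewrite gcoef0; apply: (mulfI nzG); rewrite mulr0.
(* Pairing $x$ with $g$ isolates $|G| x_g$. *)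
rewrite -(xP (gelt K g)) trace_formE (bigD1 g) //= big1 => [|h hg].
  by rewrite gcoef_gelt eqxx mulr1 addr0.
by rewrite gcoef_gelt (negPf hg) mulr0.
Qed.

(** The inverse makes the coefficient of $u z$ at $1$ equal to $b(1, z)$, where $u$ is the
    symbol. *)
Definition form_symbol (b : galg K gT -> galg K gT -> K) : galg K gT :=
  [ffun g => b 1 (gelt K g^-1%g)].

Lemma gcoef_form_symbol b g : gcoef (form_symbol b) g = b 1 (gelt K g^-1%g).
Proof. by rewrite /gcoef ffunE. Qed.

Lemma invariant_formE (b : galg K gT -> galg K gT -> K) x y :
    form_bilinear b -> form_invariant b ->
  b x y = gcoef (form_symbol b * (gstar x * y)) 1%g.
Proof.
move=> [bl br] binv; have -> : b x y = b 1 (gstar x * y).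
  rewrite (scalar_galgE x (bl y)) mulr_suml.
  have bdist (r : seq gT) : b 1 (\sum_(g <- r) gcoef x g *: gelt K g^-1%g * y) =
      \sum_(g <- r) gcoef x g * b 1 (gelt K g^-1%g * y).
    elim: r => [|g r IHr]; last by rewrite !big_cons -scalerAl br IHr.
    rewrite !big_nil (scalar_galgE 0 (br 1)) big1 // => g _.
    by rewrite gcoef0 mul0r.
  rewrite bdist; apply: eq_bigr => g _; congr (_ * _).
  (* Translating both arguments by $g^{-1}$ turns $b(g, y)$ into $b(1, g^{-1} y)$. *)
  by rewrite -(binv g^-1%g) -geltM mulVg.
rewrite (scalar_galgE (gstar x * y) (br 1)) gcoefM (reindex_inj invg_inj).
by apply: eq_bigr => g _; rewrite gcoef_form_symbol mulg1 mulrC.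
Qed.

End GroupAlgebraTrace.

Section SquareRoot.

Variable gT : finGroupType.
Hypotheses (abelG : abelian [set: gT]) (oddG : odd #|[set: gT]|).
Implicit Types x u : galg 'F_2 gT.

Lemma mulF2_id (c : 'F_2) : c * c = c.
Proof. by case: c => [[|[|//]] ?]; apply/val_inj. Qed.

Lemma galgF2_addxx x : x + x = 0.
Proof.
by rewrite -mulr2n -scaler_nat (_ : 2%:R = 0 :> 'F_2) ?scale0r //; apply/val_inj.
Qed.

(** Squaring is additive because the two equal cross terms cancel, and $c^2 = c$ for scalars in
    $\mathbb{F}_2$. *)
Lemma galgF2_sqr x : x * x = \sum_g gcoef x g *: gelt 'F_2 (g * g)%g.
Proof.
rewrite {1 2}[x]galg_sum_gelt.
apply: (big_rec2 (fun y z => y * y = z)) => [|g y z _ <-]; first exact: mul0r.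
rewrite mulrDl !mulrDr (galg_mulC y (_ *: _) abelG).
rewrite -addrA [X in _ + X]addrA galgF2_addxx add0r.
by rewrite -scalerAl -scalerAr scalerA mulF2_id geltM.
Qed.

Lemma sqrg_inj : injective (fun g : gT => (g * g)%g).
Proof.
have co2 : coprime #|[set: gT]| 2 by rewrite coprimen2.
(* As 2 is prime to the group order, a further power map recovers $g$ from $g^2$. *)
move=> g h /= ghE; rewrite -(expgK co2 (in_setT g)) -(expgK co2 (in_setT h)).
by rewrite !expgS !expg0 !mulg1 ghE.
Qed.

Definition gsqrt u : galg 'F_2 gT := [ffun g => gcoef u (g * g)%g].

Lemma gcoef_gsqrt u g : gcoef (gsqrt u) g = gcoef u (g * g)%g.
Proof. by rewrite /gcoef ffunE. Qed.

Lemma gsqrtK u : gsqrt u * gsqrt u = u.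
Proof.
rewrite galgF2_sqr [RHS]galg_sum_gelt [RHS](reindex_inj sqrg_inj).
by apply: eq_bigr => g _; rewrite gcoef_gsqrt.
Qed.

Lemma gstar_gsqrt u : gstar (gsqrt u) = gsqrt (gstar u).
Proof.
by apply: galgP => g; rewrite !(gcoef_gstar, gcoef_gsqrt) invMg.
Qed.

End SquareRoot.

Theorem theorem3p22 (gT : finGroupType)
    (abelG : abelian [set: gT]) (oddG : odd #|[set: gT]|) :
  inv_sym_nondeg_form (@trace_form 'F_2 gT) /\
  forall b' : galg 'F_2 gT -> galg 'F_2 gT -> 'F_2,
    inv_sym_nondeg_form b' ->
    exists phi : {linear galg 'F_2 gT -> galg 'F_2 gT},
      [/\ bijective phi, equivariant phi
        & forall x y, b' (phi x) (phi y) = trace_form x y].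
Proof.
have cardG1 : #|gT|%:R = 1 :> 'F_2.
  by rewrite -cardsT; apply/val_inj; rewrite /= val_Fp_nat // modn2 oddG.
split; first by apply: trace_form_inv_sym_nondeg; rewrite cardG1 oner_eq0.
move=> b [blin binv bsym bnd].
pose u := form_symbol b.
(* $b(1, g) = b(g, 1) = b(1, g^{-1})$, by symmetry and then translation by $g^{-1}$. *)
have u_star : gstar u = u.
  apply: galgP => g; rewrite gcoef_gstar !gcoef_form_symbol invgK bsym.
  by rewrite -(binv g^-1%g) -geltM mulVg mulr1.
pose v := gsqrt u.
have v_star : gstar v = v by rewrite gstar_gsqrt u_star.
have bE x y : b x y = trace_form (v * x) (v * y).
  rewrite /trace_form algTr_galg cardG1 mul1r invariant_formE // -/u.
  rewrite -(gsqrtK abelG oddG u) -/v gstarM v_star (galg_mulC _ v abelG).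
  by rewrite -!mulrA [in RHS](mulrA (gstar x)) (galg_mulC (gstar x) v abelG) -!mulrA.
(* If $v x = v y$, then $x - y$ lies in the radical of $b$. *)
have ker0 : lker (amull v) == 0%VS.
  apply/lker0P => x y; rewrite !lfunE /= => vxy.
  apply/eqP; rewrite -subr_eq0; apply/eqP/bnd => z.
  rewrite bE mulrBr vxy subrr trace_formE big1 ?mulr0 // => g _.
  by rewrite gcoef0 mul0r.
have phiK x : v * (amull v)^-1%VF x = x.
  by have := lker0_lfunVK ker0 x; rewrite lfunE.
exists (amull v)^-1%VF; split=> [|s x|x y]; last by rewrite bE !phiK.
- by exists (amull v); [exact: lker0_lfunVK | exact: lker0_lfunK].
(* Equivariance may be checked after multiplying by $v$, where both sides become $s x$. *)
have /lker0P mulv_inj := ker0; apply: mulv_inj; rewrite !lfunE /= phiK.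
by rewrite mulrA (galg_mulC v _ abelG) -mulrA phiK.
Qed.
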